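(* Consider the nonmonotone Levenberg--Marquardt algorithm for $\min_{x\in\mathbb{R}^d}\frac12\|F(x)\|^2$ subject to $C(x)=0$ described in the context, and suppose that assumptions (A1)--(A4) of the context hold. If the algorithm does not terminate finitely, then $\lim_{j\to\infty}\|C_j\|=0$, where $C_j=C(x_j)$.
   Context: **Problem and notation.** $\|\cdot\|$ is the Euclidean vector norm or the matrix $\ell_2$-norm, $\langle\cdot,\cdot\rangle$ the dot product. $F:\mathbb{R}^d\to\mathbb{R}^m$ and $C:\mathbb{R}^d\to\mathbb{R}^p$ have Jacobians $J^F(x)$, $J^c(x)$. Put $f(x)=\frac12\|F(x)\|^2$, $\phi(x)=\frac12\|C(x)\|^2$, $\mathcal{L}(x,y)=f(x)+y^\top C(x)$. At the iterate $x_j$ write $F_j=F(x_j)$, $C_j=C(x_j)$, $J^F_j=J^F(x_j)$, $J^c_j=J^c(x_j)$. $W_j\in\mathbb{R}^{d\times d}$ is the projection matrix onto the null space of $J^c_j$, with $W_j=W_j^\top=W_j^2$. $\gamma_j>0$ is a regularization parameter and $y_j\in\mathbb{R}^p$ a Lagrange multiplier estimate. **Constants.** $\rho_1,\rho_2\in(0,1)$; $0<\hat\gamma_1<1<\hat\gamma_2$; $\gamma_{\min}>0$; $0<\alpha,\beta<1/2$; $2/3<\xi<1$; $\kappa_1,\kappa_2,\xi_0,\xi_1,\xi_2>0$; positive integers $\nu,\nu^l$; $\mu\in(0,1/m)$; $\alpha_0\in(0,1)$; a fixed $\eta$ with $4/3<\eta<4$; a sequence $\{a_k\}_{k\ge0}$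 with $a_k>0$, $\alpha_0\le a_{k+1}/a_k<1$, $\lim_k a_k=0$, $\sum_k a_k^\eta=\infty$. **Quantities and conditions on the steps.** Quasi-normal step: with $m^c_j(n)=\frac12\|C_j+J^c_jn\|^2+\frac12\gamma_j\|n\|^2$, $n_j$ is an approximate (possibly exact) minimizer of $m^c_j$, required to satisfy (N) $m^c_j(0)-m^c_j(n_j)\ge\kappa_1\|C_j\|^2/(\|J^c_j\|^2+\gamma_j)$. Let $H_j=(J^F_j)^\top J^F_j+\gamma_jI_d$, $\nabla\mathcal{L}_j=(J^F_j)^\top F_j+(J^c_j)^\top y_j$, $g_j=\nabla\mathcal{L}_j+H_jn_j$. $\widetilde W_j(\cdot)$ is an approximation of the application of $W_j$, required to satisfy (W) $\|\widetilde W_j(n_j)-W_jn_j\|\le\xi_0/\gamma_j^2$ and $\|\widetilde W_j(g_j)-W_jg_j\|\le\xi_1/\gamma_j$. Write $\hat g_j=\widetilde W_j(g_j)$. Inexact tangential step: $\widetilde t_j=\widetilde W_j(w_j)$ is an approximate (possibly exact) solution of $\min_{\widetilde t}\frac12\langle H_j\widetilde t,\widetilde t\rangle+\langle\widetilde W_j(g_j),\widetilde t\rangle$, over vectors of the form $\widetilde t=\widetilde W_j(w)$, $w\in\mathbb{R}^d$. With $\mathrm{pred}^t_j=-\frac12\langle H_j\widetilde t_j,\widetilde t_j\rangle-\langle\widetilde W_j(g_j),\widetilde t_j\rangle$, it is required to satisfy (T) $\mathrm{pred}^t_j\ge\kappa_2\|\widetilde W_j(g_j)\|^2/(\|J^F_j\|^2+\gamma_j)$.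 The vector $t_j$ is required to satisfy (P) $\|t_j-W_j\widetilde t_j\|\le\xi_2/\gamma_j^2$. Put $\widetilde s_j=n_j+\widetilde t_j$ and $s_j=n_j+t_j$. Reductions: $\mathrm{pred}^c_j=\phi(x_j)-m^c_j(n_j)$; $\mathrm{ared}^c_j=\phi(x_j)-\phi(x_j+s_j)$; $\mathrm{rared}^c_j=\frac12\max\{R_j,\sum_{k=0}^{\nu^c_j-1}\mu^c_{jk}\|C_{j-k}\|^2\}-\frac12\|C(x_j+s_j)\|^2$; $\mathrm{pred}^l_j=-\frac12\langle H_jn_j,n_j\rangle-\langle\nabla\mathcal{L}_j,n_j\rangle+\mathrm{pred}^t_j+\frac12\langle\gamma_jt_j+g_j,n_j-\widetilde W_j(n_j)\rangle$; $\mathrm{ared}^l_j=\mathcal{L}(x_j,y_j)-\mathcal{L}(x_j+s_j,y_j)$; $\mathrm{rared}^l_j=\max\{\mathcal{L}(x_j,y_j),\sum_{k=0}^{\nu^l_j-1}\mu^l_{jk}\mathcal{L}(x_{j-k},y_{j-k})\}-\mathcal{L}(x_j+s_j,y_j)$. Here $\nu^c_j=\min(j+1,\nu)$, $\nu^l_j=\min(j+1,\nu^l)$, $\mu^c_{jk}\ge\mu$, $\mu^l_{jk}\ge\mu$, $\sum_{k=0}^{\nu^c_j-1}\mu^c_{jk}=1$, $\sum_{k=0}^{\nu^l_j-1}\mu^l_{jk}=1$, and $R_j\ge\|C_j\|^2$ is defined in Step 2. **Algorithm.** Choose $x_0$, $\gamma_0>0$ and set $k_0=0$. For $j=0,1,\dots$: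 Step 1: evaluate $F_j,J^F_j,C_j,J^c_j,g_j$ and a Lagrange multiplier estimate $y_j$. Step 2: choose the weights $\mu^c_{jk}$, $\mu^l_{jk}$ and update $R_j$ as follows. If $\|C_j\|<\min\{\alpha a_{k_j},\beta\|\hat g_j\|\}$, set $R_j=\min\{a_{k_j}^2,\|\hat g_j\|^2\}$, and set $k_{j+1}=k_j+1$ if $R_j\ge\sum_{k=0}^{\nu^c_j-1}\mu^c_{jk}\|C_{j-k}\|^2$, $k_{j+1}=k_j$ otherwise. Else set $R_j=\|C_j\|^2$ and $k_{j+1}=k_j$. Step 3: compute $n_j$ such that (N) holds and $\widetilde t_j$ satisfying (W) and (T); set $\widetilde s_j=n_j+\widetilde t_j$. Step 4: compute $t_j$ satisfying (P) and set $s_j=n_j+t_j$. Step 5: if $\mathrm{pred}^t_j\ge\max\{\mathrm{pred}^c_j,(\mathrm{pred}^c_j)^\xi\}$ and $\mathrm{pred}^l_j\ge\rho_2\mathrm{pred}^t_j$, the step is accepted when both $\mathrm{rared}^c_j\ge\rho_1\mathrm{pred}^c_j$ and $\mathrm{rared}^l_j\ge\rho_1\mathrm{pred}^l_j$, and rejected otherwise. In the remaining case the step is accepted when $\mathrm{rared}^c_j\ge\rho_1\mathrm{pred}^c_j$, and rejected otherwise. On acceptance, set $x_{j+1}=x_j+s_j$, replace the regularization parameter by $\max(\gamma_{\min},\hat\gamma_1\gamma_j)$, and pass to iteration $j+1$ with this value. On rejection, replace $\gamma_j$ by $\hat\gamma_2\gamma_j$ and go to Step 4. **Assumptions.** (A1)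 The sequence $\{x_j,x_j+s_j\}$ lies in a compact set $\Omega$. (A2) $F$ and $C$ are continuously differentiable (thus so is $\phi$), and the gradients of $f$, $\phi$ and each component $C_i$ of $C$ are Lipschitz continuous. (A3) There exist $\kappa^c_{JJ}>0$ and $\kappa_W>0$ such that for every index $j$, $\|(J^c_j(J^c_j)^\top)^{-1}\|\le\kappa^c_{JJ}$ and $\|\widetilde W_j(x)\|\le\kappa_W\|x\|$ for any $x$. (A4) There exists $\kappa_y>0$ such that $\|y_j\|\le\kappa_y$ for every $j$. *)

(* Defs.v *)
From HB Require Import structures.
From mathcomp Require Import all_boot all_order all_algebra.
From mathcomp Require Import all_classical all_reals all_analysis.

Set Implicit Arguments.
Unset Strict Implicit.
Unset Printing Implicit Defensive.

Import Order.TTheory GRing.Theory Num.Theory.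
Import numFieldNormedType.Exports.

Local Open Scope classical_set_scope.
Local Open Scope ring_scope.

Section Euclidean.
Context {R : realType}.

Definition dot d (u v : 'cV[R]_d) : R := \sum_i u i 0 * v i 0.

(* The library norm of a matrix is the maximum norm of its entries. *)
Definition enorm d (u : 'cV[R]_d) : R := Num.sqrt (dot u u).

(* Matrix l2-norm, i.e. the operator norm induced by [enorm]. *)
Definition opnorm k d (A : 'M[R]_(k, d)) : R :=
  sup [set enorm (A *m v) | v in [set v : 'cV[R]_d | enorm v <= 1]].

(* The library [jacobian] is for maps between row vectors and is transposed
   with respect to this one. *)
Definition jac d k (G : 'cV[R]_d -> 'cV[R]_k) (x : 'cV[R]_d) : 'M[R]_(k, d) :=
  \matrix_(i < k, j < d) ('d G x (delta_mx j 0) : 'cV[R]_k) i 0.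

Definition grad d (h : 'cV[R]_d -> R) (x : 'cV[R]_d) : 'cV[R]_d :=
  \col_(j < d) ('d h x (delta_mx j 0) : R).

Definition C1 d k (G : 'cV[R]_d -> 'cV[R]_k) : Prop :=
  (forall x, differentiable G x) /\ continuous (jac G).

Definition lipschitz_grad d (h : 'cV[R]_d -> R) : Prop :=
  exists L : R, forall u v, enorm (grad h u - grad h v) <= L * enorm (u - v).

Definition half_sqnorm d k (G : 'cV[R]_d -> 'cV[R]_k) (x : 'cV[R]_d) : R :=
  2^-1 * enorm (G x) ^+ 2.

Definition null_space_projection k d (J : 'M[R]_(k, d)) (W : 'M[R]_d) : Prop :=
  [/\ W^T = W, W *m W = W
    & forall v : 'cV[R]_d, J *m v = 0 <-> exists u : 'cV[R]_d, v = W *m u].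

End Euclidean.

Record params (R : realType) := Params {
  rho1 : R; rho2 : R;
  ghat1 : R; ghat2 : R; gmin : R;
  alpha : R; beta : R; xi : R;
  kappa1 : R; kappa2 : R; xi0 : R; xi1 : R; xi2 : R;
  nu : nat; nul : nat; mu : R;
  alpha0 : R; eta : R; aseq : nat -> R
}.

Record valid_params (R : realType) (m : nat) (P : params R) : Prop := {
  rho1_range : 0 < rho1 P < 1;
  rho2_range : 0 < rho2 P < 1;
  ghat1_range : 0 < ghat1 P < 1;
  ghat2_range : 1 < ghat2 P;
  gmin_gt0 : 0 < gmin P;
  alpha_range : 0 < alpha P < 2^-1;
  beta_range : 0 < beta P < 2^-1;
  xi_range : 2 / 3 < xi P < 1;
  kappa1_gt0 : 0 < kappa1 P;
  kappa2_gt0 : 0 < kappa2 P;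
  xi0_gt0 : 0 < xi0 P;
  xi1_gt0 : 0 < xi1 P;
  xi2_gt0 : 0 < xi2 P;
  nu_gt0 : (0 < nu P)%N;
  nul_gt0 : (0 < nul P)%N;
  mu_range : 0 < mu P < m%:R^-1;
  alpha0_range : 0 < alpha0 P < 1;
  eta_range : 4 / 3 < eta P < 4;
  aseq_gt0 : forall k, 0 < aseq P k;
  aseq_ratio : forall k, alpha0 P <= aseq P k.+1 / aseq P k < 1;
  aseq_cvg : aseq P @ \oo --> (0 : R);
  aseq_dvg : series (fun k => aseq P k `^ eta P) @ \oo --> +oo
}.

(* The outcome of Step 3.  [lam] is the value of the regularization parameter
   for which Step 3 was carried out; [wv] is the vector w_j with
   ttilde_j = Wtil (w_j). *)
Record step3 (R : realType) (d : nat) := Step3 {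
  lam : R;
  nv : 'cV[R]_d;
  Wtil : 'cV[R]_d -> 'cV[R]_d;
  wv : 'cV[R]_d
}.

Definition ttil (R : realType) (d : nat) (z : step3 R d) : 'cV[R]_d :=
  Wtil z (wv z).

(* One pass through Steps 4-5, with regularization parameter [gam]. *)
Record trial (R : realType) (d : nat) := Trial {
  gam : R;
  st3 : step3 R d;
  tv : 'cV[R]_d
}.

Definition sv (R : realType) (d : nat) (T : trial R d) : 'cV[R]_d :=
  nv (st3 T) + tv T.

(* Iteration j makes the trials [tr j 0], ..., [tr j (rej j)]: the first
   [rej j] of them are rejected and the last one is accepted.  The values
   [tr j i] with [rej j < i] are irrelevant. *)
Record run (R : realType) (d p : nat) := Run {
  xs : nat -> 'cV[R]_d;
  ys : nat -> 'cV[R]_p;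
  Ws : nat -> 'M[R]_d;
  muc : nat -> nat -> R;
  mul : nat -> nat -> R;
  Rs : nat -> R;
  ks : nat -> nat;
  rej : nat -> nat;
  tr : nat -> nat -> trial R d
}.

Section Algorithm.
Context {R : realType} {d m p : nat}.
Variables (F : 'cV[R]_d -> 'cV[R]_m) (C : 'cV[R]_d -> 'cV[R]_p).
Variable P : params R.

Definition Lag (x : 'cV[R]_d) (y : 'cV[R]_p) : R :=
  half_sqnorm F x + dot y (C x).

Definition gradL (x : 'cV[R]_d) (y : 'cV[R]_p) : 'cV[R]_d :=
  (jac F x)^T *m F x + (jac C x)^T *m y.

Definition Hmat (x : 'cV[R]_d) (l : R) : 'M[R]_d :=
  (jac F x)^T *m jac F x + l%:M.

Definition mc (x : 'cV[R]_d) (l : R) (n : 'cV[R]_d) : R :=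
  2^-1 * enorm (C x + jac C x *m n) ^+ 2 + 2^-1 * l * enorm n ^+ 2.

Definition gvec (x : 'cV[R]_d) (y : 'cV[R]_p) (z : step3 R d) : 'cV[R]_d :=
  gradL x y + Hmat x (lam z) *m nv z.

Definition ghat x y (z : step3 R d) : 'cV[R]_d := Wtil z (gvec x y z).

Definition predc x (z : step3 R d) : R :=
  half_sqnorm C x - mc x (lam z) (nv z).

Definition predt x y (z : step3 R d) : R :=
  - (2^-1 * dot (Hmat x (lam z) *m ttil z) (ttil z))
  - dot (ghat x y z) (ttil z).

Definition predl x y (T : trial R d) : R :=
  let z := st3 T in
  - (2^-1 * dot (Hmat x (lam z) *m nv z) (nv z)) - dot (gradL x y) (nv z)
  + predt x y z
  + 2^-1 * dot (gam T *: tv T + gvec x y z) (nv z - Wtil z (nv z)).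

Definition condN x (z : step3 R d) : Prop :=
  mc x (lam z) 0 - mc x (lam z) (nv z) >=
  kappa1 P * enorm (C x) ^+ 2 / (opnorm (jac C x) ^+ 2 + lam z).

Definition condW x y (W : 'M[R]_d) (z : step3 R d) : Prop :=
  enorm (Wtil z (nv z) - W *m nv z) <= xi0 P / lam z ^+ 2 /\
  enorm (ghat x y z - W *m gvec x y z) <= xi1 P / lam z.

Definition condT x y (z : step3 R d) : Prop :=
  predt x y z >=
  kappa2 P * enorm (ghat x y z) ^+ 2 / (opnorm (jac F x) ^+ 2 + lam z).

Definition condP (W : 'M[R]_d) (T : trial R d) : Prop :=
  enorm (tv T - W *m ttil (st3 T)) <= xi2 P / gam T ^+ 2.

Variable r : run R d p.

Definition nuc_j (j : nat) : nat := minn j.+1 (nu P).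
Definition nul_j (j : nat) : nat := minn j.+1 (nul P).

Definition avgC (j : nat) : R :=
  \sum_(k < nuc_j j) muc r j k * enorm (C (xs r (j - k))) ^+ 2.

Definition avgL (j : nat) : R :=
  \sum_(k < nul_j j) mul r j k * Lag (xs r (j - k)) (ys r (j - k)).

Definition raredc (j : nat) (T : trial R d) : R :=
  2^-1 * Num.max (Rs r j) (avgC j) - 2^-1 * enorm (C (xs r j + sv T)) ^+ 2.

Definition raredl (j : nat) (T : trial R d) : R :=
  Num.max (Lag (xs r j) (ys r j)) (avgL j) - Lag (xs r j + sv T) (ys r j).

Definition accepted (j : nat) (T : trial R d) : bool :=
  let pc := predc (xs r j) (st3 T) in
  let pt := predt (xs r j) (ys r j) (st3 T) in
  let pl := predl (xs r j) (ys r j) T in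
  if (pt >= Num.max pc (pc `^ xi P)) && (pl >= rho2 P * pt)
  then (raredc j T >= rho1 P * pc) && (raredl j T >= rho1 P * pl)
  else raredc j T >= rho1 P * pc.

Definition weights_ok (j : nat) : Prop :=
  [/\ forall k, (k < nuc_j j)%N -> mu P <= muc r j k,
      forall k, (k < nul_j j)%N -> mu P <= mul r j k,
      \sum_(k < nuc_j j) muc r j k = 1
    & \sum_(k < nul_j j) mul r j k = 1].

(* Step 2 is carried out once per iteration, so its ghat_j is the one of the
   first trial. *)
Definition step2_ok (j : nat) : Prop :=
  let gh := enorm (ghat (xs r j) (ys r j) (st3 (tr r j 0))) in
  let a := aseq P (ks r j) in
  if enorm (C (xs r j)) < Num.min (alpha P * a) (beta P * gh)
  then Rs r j = Num.min (a ^+ 2) (gh ^+ 2) /\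
       ks r j.+1 = (if Rs r j >= avgC j then (ks r j).+1 else ks r j)
  else Rs r j = enorm (C (xs r j)) ^+ 2 /\ ks r j.+1 = ks r j.

(* After a rejection the algorithm returns to Step 4.  Either the outcome of
   Step 3 is kept as it is, or the requirements (N), (W), (T), which depend on
   the regularization parameter, are met again for the increased parameter
   (with the same vectors n_j, ttilde_j or with updated ones). *)
Definition after_rejection (T T' : trial R d) : Prop :=
  gam T' = ghat2 P * gam T /\ (st3 T' = st3 T \/ lam (st3 T') = gam T').

Record is_execution : Prop := {
  gam0_gt0 : 0 < gam (tr r 0 0);
  ks0 : ks r 0 = 0%N;
  Ws_proj : forall j, null_space_projection (jac C (xs r j)) (Ws r j);
  weightsP : forall j, weights_ok j;
  step2P : forall j, step2_ok j;
  step3P : forall j i, (i <= rej r j)%N ->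
    let z := st3 (tr r j i) in
    [/\ condN (xs r j) z, condW (xs r j) (ys r j) (Ws r j) z
      & condT (xs r j) (ys r j) z];
  step3_first : forall j, lam (st3 (tr r j 0)) = gam (tr r j 0);
  step4P : forall j i, (i <= rej r j)%N -> condP (Ws r j) (tr r j i);
  rejectP : forall j i, (i < rej r j)%N ->
    ~~ accepted j (tr r j i) /\ after_rejection (tr r j i) (tr r j i.+1);
  acceptP : forall j, accepted j (tr r j (rej r j));
  next_x : forall j, xs r j.+1 = xs r j + sv (tr r j (rej r j));
  next_gam : forall j, gam (tr r j.+1 0) =
    Num.max (gmin P) (ghat1 P * gam (tr r j (rej r j)))
}.

(* All trial points are concerned, including the rejected ones. *)
Definition A1 : Prop := exists Omega : set 'cV[R]_d,
  [/\ compact Omega, forall j, Omega (xs r j)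
    & forall j i, (i <= rej r j)%N -> Omega (xs r j + sv (tr r j i))].

Definition A2 : Prop :=
  [/\ C1 F, C1 C, lipschitz_grad (half_sqnorm F), lipschitz_grad (half_sqnorm C)
    & forall i, lipschitz_grad (fun x => C x i 0)].

Definition A3 : Prop := exists kJJ kW : R,
  [/\ 0 < kJJ, 0 < kW,
      forall j, let A := jac C (xs r j) *m (jac C (xs r j))^T in
        A \in unitmx /\ opnorm (invmx A) <= kJJ
    & forall j i, (i <= rej r j)%N ->
        forall v, enorm (Wtil (st3 (tr r j i)) v) <= kW * enorm v].

Definition A4 : Prop := exists2 ky : R, 0 < ky & forall j, enorm (ys r j) <= ky.

End Algorithm.

(* Main.v *)
Require Import Defs.
From mathcomp Require Import all_boot all_order all_algebra.
From mathcomp Require Import all_classical all_reals all_analysis.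
From mathcomp Require Import zify ring lra.
Set Implicit Arguments.
Unset Strict Implicit.
Unset Printing Implicit Defensive.
Import Order.TTheory GRing.Theory Num.Theory.
Import numFieldNormedType.Exports.
Local Open Scope classical_set_scope.
Local Open Scope ring_scope.

(* Write c_j = |C_j|^2.  Every accepted step satisfies
   c_{j+1} <= max(R_j, avg_j) - 2 rho1 pred^c_j, where avg_j is a weighted
   average of the last nu values of c whose weights are at least mu.

   If k_j is incremented infinitely often, then at each increment
   mu c_i <= avg_j <= R_j <= a_{k_j}^2 for every i in the window, this bound
   persists afterwards, and a_k -> 0.

   Otherwise c_{j+1} <= max(c_j, avg_j) - 2 rho1 pred^c_j eventually.  The window
   maximum Q_j then decreases and Q_{j+nu} <= (1 - mu) Q_j + mu c_j, so c_j has
   the same limit q as Q_j, and pred^c_j -> 0.  Suppose q > 0.  If Step 3 is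
   carried out for the current, large enough gamma, the trial is accepted: the
   steps are O(1/gamma) and J^c t is O(1/gamma^2), so the actual reduction of phi
   is at least pred^c - O(1/gamma^2) with pred^c of order at least 1/gamma, while
   pred^t = O(1/gamma) < (pred^c)^xi because xi < 1, so that the Lagrangian is
   not tested.  Hence gamma decreases geometrically while it is large, and
   the parameter of Step 3 stays below a fixed bound infinitely often; at these
   iterations (N) keeps pred^c_j away from 0, a contradiction. *)

(** * Euclidean norms *)

Section EuclideanTheory.
Context {R : realType}.

Lemma dotC d (u v : 'cV[R]_d) : dot u v = dot v u.
Proof. by apply: eq_bigr => i _; rewrite mulrC. Qed.

Lemma dotE d (u v : 'cV[R]_d) : dot u v = (u^T *m v) 0 0.
Proof. by rewrite mxE; apply: eq_bigr => i _; rewrite mxE. Qed.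

Lemma dotDr d (u v w : 'cV[R]_d) : dot u (v + w) = dot u v + dot u w.
Proof. by rewrite !dotE mulmxDr mxE. Qed.

Lemma dotDl d (u v w : 'cV[R]_d) : dot (v + w) u = dot v u + dot w u.
Proof. by rewrite !(dotC _ u) dotDr. Qed.

Lemma dotZr d (u v : 'cV[R]_d) a : dot u (a *: v) = a * dot u v.
Proof. by rewrite !dotE -scalemxAr mxE. Qed.

Lemma dotZl d (u v : 'cV[R]_d) a : dot (a *: u) v = a * dot u v.
Proof. by rewrite dotC dotZr dotC. Qed.

Lemma dotBr d (u v w : 'cV[R]_d) : dot u (v - w) = dot u v - dot u w.
Proof. by rewrite -scaleN1r dotDr dotZr mulN1r. Qed.

Lemma dotBl d (u v w : 'cV[R]_d) : dot (v - w) u = dot v u - dot w u.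
Proof. by rewrite !(dotC _ u) dotBr. Qed.

Lemma dot_mulmxl k d (A : 'M[R]_(k, d)) u v : dot (A *m u) v = dot u (A^T *m v).
Proof. by rewrite !dotE trmx_mul mulmxA. Qed.

Lemma dot_ge0 d (u : 'cV[R]_d) : 0 <= dot u u.
Proof. by apply: sumr_ge0 => i _; rewrite -expr2 sqr_ge0. Qed.

Lemma enorm_ge0 d (u : 'cV[R]_d) : 0 <= enorm u.
Proof. exact: sqrtr_ge0. Qed.

Lemma sqr_enorm d (u : 'cV[R]_d) : enorm u ^+ 2 = dot u u.
Proof. by rewrite sqr_sqrtr ?dot_ge0. Qed.

(** Cauchy--Schwarz, by expanding the squared norm of [dot v v *: u - dot u v *: v]: it equals
    [dot v v] times the wanted difference, so [dot v v = 0] is treated apart. *)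
Lemma dot_le_enorm d (u v : 'cV[R]_d) : dot u v <= enorm u * enorm v.
Proof.
have [v0|vN0] := eqVneq (dot v v) 0.
  suff -> : dot u v = 0 by rewrite mulr_ge0 ?enorm_ge0.
  apply: big1 => i _; move/eqP: v0.
  rewrite psumr_eq0 => [/allP/(_ i)|k _]; last by rewrite -expr2 sqr_ge0.
  by rewrite mem_index_enum => /(_ isT); rewrite mulf_eq0 orbb => /eqP->; rewrite mulr0.
have v_gt0 : 0 < dot v v by rewrite lt_def vN0 dot_ge0.
have CS : dot u v ^+ 2 <= dot u u * dot v v.
  have := dot_ge0 (dot v v *: u - dot u v *: v).
  rewrite dotBl !dotBr !dotZl !dotZr (dotC v u).
  rewrite (_ : _ - _ = dot v v * (dot u u * dot v v - dot u v ^+ 2)); last by ring.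
  by rewrite pmulr_rge0 // subr_ge0.
apply: le_trans (ler_norm _) _.
rewrite -(@ler_pXn2r _ 2) ?nnegrE ?mulr_ge0 ?enorm_ge0 //.
by rewrite exprMn !sqr_enorm real_normK ?num_real.
Qed.

Lemma ler_enormD d (u v : 'cV[R]_d) : enorm (u + v) <= enorm u + enorm v.
Proof.
rewrite -(@ler_pXn2r _ 2) ?nnegrE ?addr_ge0 ?enorm_ge0 //.
rewrite sqrrD !sqr_enorm dotDl !dotDr (dotC v u).
have := dot_le_enorm u v; lra.
Qed.

Lemma enormZ d (u : 'cV[R]_d) a : enorm (a *: u) = `|a| * enorm u.
Proof.
by rewrite /enorm dotZl dotZr mulrA -expr2 sqrtrM ?sqr_ge0 // sqrtr_sqr.
Qed.

Lemma enorm0 d : enorm (0 : 'cV[R]_d) = 0.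
Proof. by rewrite -(scale0r 0) enormZ normr0 mul0r. Qed.

Lemma enormN d (u : 'cV[R]_d) : enorm (- u) = enorm u.
Proof. by rewrite -scaleN1r enormZ normrN1 mul1r. Qed.

Lemma le_dot_norm d (u v : 'cV[R]_d) : `|dot u v| <= enorm u * enorm v.
Proof.
rewrite ler_norml dot_le_enorm andbT lerNl -mulN1r -dotZl scaleN1r.
by rewrite -[enorm u]enormN dot_le_enorm.
Qed.

Lemma coord_le_enorm d (u : 'cV[R]_d) i : `|u i 0| <= enorm u.
Proof.
rewrite -sqrtr_sqr ler_wsqrtr // /dot (bigD1 i) //= -expr2 lerDl.
by apply: sumr_ge0 => k _; rewrite -expr2 sqr_ge0.
Qed.

Lemma enorm_le_coord d (u : 'cV[R]_d) M :
  (forall i, `|u i 0| <= M) -> enorm u <= d%:R * M.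
Proof.
(* In dimension 0 nothing forces [M] to be nonnegative. *)
move=> uM; case: d u uM => [|d] u uM.
  by rewrite /enorm /dot big_ord0 sqrtr0 mul0r.
have M0 : 0 <= M := le_trans (normr_ge0 _) (uM ord0).
rewrite -(@ler_pXn2r _ 2) ?nnegrE ?mulr_ge0 ?enorm_ge0 ?ler0n //.
rewrite sqr_enorm (le_trans (_ : _ <= \sum_(i < d.+1) M ^+ 2)) //.
  by apply: ler_sum => i _; rewrite -expr2 -(real_normK (num_real (u i 0))) ler_pXn2r ?nnegrE.
rewrite sumr_const card_ord -[_ *+ _]mulr_natl exprMn ler_wpM2r ?sqr_ge0 //.
by rewrite -natrX ler_nat leq_pmulr.
Qed.

Lemma enorm_mulmx_le k d (A : 'M[R]_(k, d)) M v : (forall i j, `|A i j| <= M) ->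
  enorm (A *m v) <= k%:R * d%:R * M * enorm v.
Proof.
move=> AM; rewrite -!mulrA; apply: enorm_le_coord => i; rewrite mxE.
apply: le_trans (ler_norm_sum _ _ _) _.
rewrite (le_trans (_ : _ <= \sum_(j < d) M * enorm v)) //.
  by apply: ler_sum => j _; rewrite normrM ler_pM ?coord_le_enorm.
by rewrite sumr_const card_ord mulr_natl.
Qed.

(** This bounds the denominator of (N) from above. The sign of [K] is free, so the supremum is
    compared with [|K|]. *)
Lemma opnorm_sqr_le k d (A : 'M[R]_(k, d)) K :
  (forall v, enorm (A *m v) <= K * enorm v) -> opnorm A ^+ 2 <= K ^+ 2.
Proof.
move=> AK; have ubK :
    ubound [set enorm (A *m v) | v in [set v : 'cV[R]_d | enorm v <= 1]] `|K|.
  move=> _ [v /= v1 <-]; apply: le_trans (AK v) _.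
  by have := ler_norm K; have := normr_ge0 K; have := enorm_ge0 v; nra.
have A0 :
    [set enorm (A *m v) | v in [set v : 'cV[R]_d | enorm v <= 1]] (enorm (A *m 0)).
  by exists 0 => //=; rewrite enorm0.
rewrite -(real_normK (num_real K)) ler_pXn2r ?nnegrE //.
  by apply: ge_sup => //; exists (enorm (A *m 0)).
rewrite (le_trans (enorm_ge0 (A *m 0))) //.
by apply: ub_le_sup => //; exists `|K|.
Qed.

(** As [W] is symmetric and idempotent, |Wv|^2 = <v, Wv> <= |v| |Wv|. *)
Lemma projection_enorm_le k d (J : 'M[R]_(k, d)) W (v : 'cV[R]_d) :
  null_space_projection J W -> enorm (W *m v) <= enorm v.
Proof.
move=> [WT WW _]; have [|W0] := leP (enorm (W *m v)) 0.
  by move/le_trans; apply; exact: enorm_ge0.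
rewrite -(ler_pM2r W0) -expr2 sqr_enorm dot_mulmxl WT mulmxA WW.
exact: dot_le_enorm.
Qed.

Lemma projection_null k d (J : 'M[R]_(k, d)) W (v : 'cV[R]_d) :
  null_space_projection J W -> J *m (W *m v) = 0.
Proof. by move=> [_ _ H]; apply/H; exists v. Qed.

End EuclideanTheory.

(** * Nonmonotone sequences *)

Section WeightedAverage.
Context {R : realType}.
Variables (c : nat -> R) (n : nat).
Hypotheses (n_gt0 : (0 < n)%N) (c_ge0 : forall j, 0 <= c j).

Definition window_max (j : nat) : R := \big[Num.max/0]_(k < n) c (j - k).

(* Truncated subtraction repeats [c 0] in the first windows, which does not
   change their maximum. *)
Lemma window_max_le j B :
  0 <= B -> (forall k, (k < minn j.+1 n)%N -> c (j - k) <= B) ->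
  window_max j <= B.
Proof.
move=> B0 cB; apply: bigmax_le => // k _.
have -> : (j - k = j - minn j k)%N by lia.
by apply: cB; have := ltn_ord k; lia.
Qed.

Lemma le_window_max j k : (k < n)%N -> c (j - k) <= window_max j.
Proof.
move=> kn; exact: (le_bigmax 0 (fun i : 'I_n => c (j - i)) (Ordinal kn)).
Qed.

Lemma le_window_max0 j : c j <= window_max j.
Proof. by rewrite -{1}[j]subn0; apply: le_window_max. Qed.

Lemma window_max_ge0 j : 0 <= window_max j.
Proof. exact: le_trans (le_window_max0 j). Qed.

Lemma window_maxS_le j B : window_max j <= B -> c j.+1 <= B -> window_max j.+1 <= B.
Proof.
move=> mB cB; apply: window_max_le.
  exact: le_trans (window_max_ge0 _) mB.
case=> [|k] kn; first by rewrite subn0.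
by rewrite subSS; apply: le_trans mB; apply: le_window_max; lia.
Qed.

Variables (w : nat -> nat -> R) (mu : R).
Hypothesis mu_gt0 : 0 < mu.
Hypothesis w_ge : forall j k, (k < minn j.+1 n)%N -> mu <= w j k.
Hypothesis w_sum : forall j, \sum_(k < minn j.+1 n) w j k = 1.

Definition window_avg (j : nat) : R := \sum_(k < minn j.+1 n) w j k * c (j - k).

(** The weights sum to 1, so B - avg is the weighted sum of the nonnegative gaps B - c (j - k). Only
    the term [k0], of weight at least [mu], is kept. *)
Lemma window_avg_le_contract j B k0 : (k0 < minn j.+1 n)%N ->
  (forall k, (k < minn j.+1 n)%N -> c (j - k) <= B) ->
  window_avg j <= (1 - mu) * B + mu * c (j - k0).
Proof.
move=> k0n cB; set i0 := Ordinal k0n.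
suff : 0 <= \sum_(k < minn j.+1 n) w j k * (B - c (j - k))
            - mu * (B - c (j - k0)).
  under eq_bigr do rewrite mulrBr.
  by rewrite sumrB -mulr_suml w_sum mul1r -/(window_avg j); lra.
rewrite (bigD1 i0) //= addrAC addr_ge0 //.
  by rewrite -mulrBl mulr_ge0 // subr_ge0 ?w_ge ?cB.
apply: sumr_ge0 => k _; rewrite mulr_ge0 ?subr_ge0 ?cB //.
exact/(le_trans (ltW mu_gt0))/w_ge.
Qed.

Lemma window_avg_le j B : (forall k, (k < minn j.+1 n)%N -> c (j - k) <= B) ->
  window_avg j <= B.
Proof.
move=> cB; have k0 : (0 < minn j.+1 n)%N by lia.
have := window_avg_le_contract k0 cB; have := cB _ k0; move: mu_gt0; nra.
Qed.

Lemma window_avg_le_max j : window_avg j <= window_max j.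
Proof. by apply: window_avg_le => k kn; apply: le_window_max; lia. Qed.

Lemma window_avg_ge j k0 : (k0 < minn j.+1 n)%N -> mu * c (j - k0) <= window_avg j.
Proof.
move=> k0n; rewrite /window_avg (bigD1 (Ordinal k0n)) //=.
rewrite -[leLHS]addr0 lerD ?ler_wpM2r ?w_ge //.
apply: sumr_ge0 => k _; rewrite mulr_ge0 //.
exact/(le_trans (ltW mu_gt0))/w_ge.
Qed.

(** The window at index 0 has a single entry, whose weight is 1. *)
Lemma weight_le1 : mu <= 1.
Proof.
have n1 : minn 1 n = 1%N by exact/minn_idPl.
by have := w_sum 0; rewrite n1 big_ord1 => <-; apply: w_ge; rewrite n1.
Qed.

Section Nonmonotone.
Variable J : nat.
Hypothesis c_step :
  forall j, (J <= j)%N -> c j.+1 <= Num.max (c j) (window_avg j).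

Lemma window_max_decr i j : (J <= i)%N -> (i <= j)%N -> window_max j <= window_max i.
Proof.
move=> Ji; elim: j => [|j IH]; first by rewrite leqn0 => /eqP->.
rewrite leq_eqVlt => /predU1P[-> //|]; rewrite ltnS => ij.
apply: le_trans (IH ij); apply: window_maxS_le => //.
apply: le_trans (c_step _) _; first by lia.
by rewrite ge_max le_window_max0 window_avg_le_max.
Qed.

(** The value c_j stays in the windows at j, ..., j + n - 1, so each of these averages puts weight
    at least [mu] on it. By induction c_{j+1}, ..., c_{j+n} are at most [B], and they fill the
    window at j + n. *)
Lemma window_max_contract j : (J <= j)%N ->
  window_max (j + n) <= (1 - mu) * window_max j + mu * c j.
Proof.
move=> Jj; set B := _ + _.
have cjB : c j <= B.
  by rewrite /B; have := le_window_max0 j; have := weight_le1; nra.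
have cB i : (i <= n)%N -> c (j + i) <= B.
  elim: i => [|i IH] iltn; first by rewrite addn0.
  rewrite addnS; apply: le_trans (c_step _) _; first by lia.
  rewrite ge_max IH ?(ltnW iltn) //=.
  have iw : (i < minn (j + i).+1 n)%N by lia.
  rewrite (le_trans (@window_avg_le_contract _ (window_max j) _ iw _)) //.
    move=> k kn; apply: le_trans (@window_max_decr j (j + i) _ _); [|lia..].
    by apply: le_window_max; lia.
  by rewrite addnK.
apply: window_max_le => [|k kn]; first exact: le_trans (c_ge0 j) cjB.
by rewrite -addnBA; [apply: cB|]; lia.
Qed.

Lemma nonmonotone_cvg : exists2 q : R,
  c @ \oo --> q & window_max @ \oo --> q.
Proof.
have Qcvg : window_max @ \oo --> inf (range (fun j => window_max (j + J))).
  rewrite -(cvg_shiftn J); apply: nonincreasing_cvgn => [i j ij|].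
    by apply: window_max_decr; lia.
  by exists 0 => _ [j _ <-]; apply: window_max_ge0.
move: Qcvg; set q := inf _ => Qcvg; exists q => //.
(* Solving [window_max_contract] for c_j gives a lower bound with the same limit as the upper bound
   [window_max]. *)
have lowcvg : (fun j => (window_max (j + n) - (1 - mu) * window_max j) / mu)
    @ \oo --> q.
  have -> : q = (q - (1 - mu) * q) / mu by field; rewrite gt_eqF.
  apply: cvgMr_tmp; apply: cvgB; first by rewrite (cvg_shiftn n).
  exact: cvgMl_tmp.
apply: (squeeze_cvgr _ lowcvg Qcvg); near=> j; rewrite le_window_max0 andbT.
rewrite ler_pdivrMr // [leRHS]mulrC lerBlDl.
by apply: window_max_contract; near: j; exact: nbhs_infty_ge.
Unshelve. all: by end_near. Qed.

End Nonmonotone.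
End WeightedAverage.

(** * Descent estimates *)

Section Calculus.
Context {R : realType}.

Lemma diff_grad d (h : 'cV[R]_d -> R) x v : 'd h x v = dot (grad h x) v.
Proof.
rewrite {1}[v]matrix_sum_delta raddf_sum; apply: eq_bigr => j _.
rewrite big_ord1; apply: etrans (linearZZ ('d h x) (v j 0) (delta_mx j 0)) _.
by rewrite /= mxE mulrC.
Qed.

Lemma diff_jac d k (G : 'cV[R]_d -> 'cV[R]_k) x v : 'd G x v = jac G x *m v.
Proof.
rewrite {1}[v]matrix_sum_delta raddf_sum; apply/colP => i.
rewrite summxE mxE; apply: eq_bigr => j _; rewrite big_ord1.
apply: etrans (congr1 (fun A : 'cV[R]_k => A i 0)
  (linearZZ ('d G x) (v j 0) (delta_mx j 0))) _.
by rewrite /= !mxE mulrC.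
Qed.

Lemma is_derive_coord k (u v : 'cV[R]_k) i :
  is_derive u v (fun z : 'cV[R]_k => z i 0 : R) (v i 0).
Proof.
apply: DeriveDef; first exact: diff_derivable (differentiable_coord _ _ _).
have dv : derivable (id : 'cV[R]_k -> 'cV[R]_k) u v by exact: derivable_id.
by have /colP/(_ i) := derive_mx dv; rewrite derive_id mxE => ->.
Qed.

Lemma is_derive_half_sqr_enorm k (u v : 'cV[R]_k) :
  is_derive u v (fun z : 'cV[R]_k => 2^-1 * enorm z ^+ 2) (dot u v).
Proof.
have -> : (fun z : 'cV[R]_k => 2^-1 * enorm z ^+ 2) =
    \sum_(i < k) (fun z : 'cV[R]_k => 2^-1 * z i 0 ^+ 2).
  by apply/funext => z; rewrite fct_sumE sqr_enorm mulr_sumr.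
rewrite /dot; apply: is_derive_sum => i.
have dc := is_deriveZ 2^-1 (is_deriveX 2 (is_derive_coord u v i)).
apply: (is_derive_eq dc); rewrite /= /GRing.scale /= expr1; by field.
Qed.

Lemma differentiable_half_sqr_enorm k (u : 'cV[R]_k) :
  differentiable (fun z : 'cV[R]_k => 2^-1 * enorm z ^+ 2) u.
Proof.
have -> : (fun z : 'cV[R]_k => 2^-1 * enorm z ^+ 2) =
    \sum_(i < k) (fun z : 'cV[R]_k => 2^-1 * z i 0 ^+ 2).
  by apply/funext => z; rewrite fct_sumE sqr_enorm mulr_sumr.
apply: differentiable_sum => i.
have dc := @differentiable_coord R k 1 u i 0.
exact: (differentiableZ 2^-1 (differentiableX 1 dc)).
Qed.

Lemma differentiable_half_sqnorm d k (G : 'cV[R]_d -> 'cV[R]_k) x :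
  differentiable G x -> differentiable (half_sqnorm G) x.
Proof.
move=> dG; exact: (differentiable_comp dG (differentiable_half_sqr_enorm (G x))).
Qed.

Lemma dot_grad_half_sqnorm d k (G : 'cV[R]_d -> 'cV[R]_k) x v :
  differentiable G x -> dot (grad (half_sqnorm G) x) v = dot (G x) (jac G x *m v).
Proof.
move=> dG; have dg := differentiable_half_sqr_enorm (G x).
rewrite -diff_grad.
rewrite (diff_comp dG dg) /= diff_jac // -deriveE //.
exact: (@derive_val _ _ _ _ _ _ _ (is_derive_half_sqr_enorm _ _)).
Qed.

(** The descent lemma, by the mean value theorem on the segment from x to x + s. This costs a factor
    2 in the usual constant L / 2, which is harmless here. The Lipschitz constant may be negative,
    hence [|L|]. *)
Lemma lipschitz_grad_upper d (h : 'cV[R]_d -> R) : (forall x, differentiable h x) ->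
  lipschitz_grad h -> exists2 L : R, 0 <= L &
  forall x s, h (x + s) <= h x + dot (grad h x) s + L * enorm s ^+ 2.
Proof.
move=> dh [L hL]; exists `|L| => // x s.
pose f (t : R) := h (x + t *: s).
have df (t : R) : is_derive t 1 f (dot (grad h (x + t *: s)) s).
  pose l (t : R) := x + t *: s.
  have dl : is_diff t l ( *:%R^~ s).
    by rewrite -[X in is_diff _ _ X]add0r; exact: (is_diffD (is_diff_cst x t)).
  have dlt : differentiable l t by [].
  have dfl := differentiable_comp dlt (dh (l t)).
  apply: DeriveDef; first exact/derivable1_diffP.
  rewrite deriveE // (diff_comp dlt (dh (l t))) /= diff_val scale1r.
  by rewrite diff_grad.
have [|t /andP[/= t0 t1]] := @MVT R f _ 0 1 ltr01 (fun t _ => df t).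
  by apply: derivable_within_continuous => t _; apply: ex_derive.
rewrite /f scale1r scale0r addr0 subr0 mulr1 => hs.
rewrite -lerBlDl opprD addrA hs -dotBl.
apply: le_trans (dot_le_enorm _ _) _.
rewrite expr2 mulrA ler_wpM2r ?enorm_ge0 //.
apply: le_trans (hL _ _) _; rewrite addrAC subrr add0r enormZ.
have := ler_norm L; have := enorm_ge0 s; move: t0 t1.
rewrite !bnd_simp => t0 t1 e0 L0; rewrite ger0_norm; last by lra.
rewrite mulrA ler_wpM2r //; have := normr_ge0 L; nra.
Qed.

Lemma compact_continuous_bound d k l (G : 'cV[R]_d -> 'M[R]_(k, l)) (A : set 'cV[R]_d) :
  compact A -> continuous G ->
  exists M, forall x, A x -> forall i j, `|G x i j| <= M.
Proof.
move=> cA cG; have /compact_bounded : compact (G @` A).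
  by apply: continuous_compact cA; exact: continuous_subspaceT.
move=> [M [_ AM]]; exists (M + 1) => x Ax i j.
have M1 : M < M + 1 by lra.
apply: le_trans (AM _ M1 _ (imageP G Ax)).
by rewrite [leRHS]/Num.Def.normr /= mx_normrE (le_bigmax 0 (fun ij => `|G x ij.1 ij.2|) (i, j)).
Qed.
End Calculus.

(** * Steps of the algorithm *)

Section Bounds.
Context {R : realType}.

(** The Jacobian bounds are stated on vectors, which avoids the supremum in [opnorm]. *)
Definition value_jac_bound d k (G : 'cV[R]_d -> 'cV[R]_k) (K : R) (x : 'cV[R]_d) :=
  [/\ enorm (G x) <= K, forall v, enorm (jac G x *m v) <= K * enorm v
    & forall u, enorm ((jac G x)^T *m u) <= K * enorm u].

Lemma C1_bounds d k (G : 'cV[R]_d -> 'cV[R]_k) (A : set 'cV[R]_d) :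
  compact A -> C1 G -> exists2 K : R, 0 <= K &
  forall x, A x -> value_jac_bound G K x.
Proof.
move=> cA [dG cJ].
have cG : continuous G by move=> x; exact/differentiable_continuous/dG.
have [M0 GM] := compact_continuous_bound cA cG.
have [M1 JM] := compact_continuous_bound cA cJ.
exists (k%:R * `|M0| + k%:R * d%:R * `|M1|); first by rewrite addr_ge0 ?mulr_ge0.
have K0 : 0 <= k%:R * `|M0| by rewrite mulr_ge0.
have K1 : 0 <= k%:R * d%:R * `|M1| by rewrite !mulr_ge0.
move=> x Ax; split=> [|v|u].
- rewrite (le_trans (@enorm_le_coord _ _ _ `|M0| _)) ?lerDl // => i.
  exact: le_trans (GM _ Ax _ _) (ler_norm _).
- rewrite (le_trans (@enorm_mulmx_le _ _ _ _ `|M1| _ _)) => [//|i j|].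
    exact: le_trans (JM _ Ax _ _) (ler_norm _).
  by rewrite ler_wpM2r ?enorm_ge0 ?lerDr.
rewrite (le_trans (@enorm_mulmx_le _ _ _ _ `|M1| _ _)) => [//|i j|].
  by rewrite mxE; exact: le_trans (JM _ Ax _ _) (ler_norm _).
by rewrite [_ * k%:R]mulrC ler_wpM2r ?enorm_ge0 ?lerDr.
Qed.

(** Meant for A / g above pred^t and b / g below pred^c. Since (b / g)^xi = b^xi g^(1 - xi) / g and
    xi < 1, it suffices that g^(1 - xi) exceeds |A| / b^xi; the summand 1 in [E] makes this
    strict. *)
Lemma linear_decay_lt_powR (A b xi : R) : 0 < b -> 0 < xi < 1 ->
  exists G : R, forall g, G <= g -> 0 < g -> A / g < (b / g) `^ xi.
Proof.
move=> b0 /andP[xi0 xi1]; pose E := `|A| / b `^ xi + 1.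
have bx : 0 < b `^ xi by exact: powR_gt0.
have E0 : 0 < E by rewrite ltr_wpDl // divr_ge0 // ltW.
exists (E `^ (1 - xi)^-1) => g Gg g0.
have gx : 0 < g `^ xi by exact: powR_gt0.
have Eg : E <= g `^ (1 - xi).
  have : (E `^ (1 - xi)^-1) `^ (1 - xi) <= g `^ (1 - xi).
    have x0 : 0 <= 1 - xi by rewrite subr_ge0 ltW.
    by apply: (ge0_ler_powR x0 _ _ Gg); rewrite nnegrE ?powR_ge0 ?ltW.
  by rewrite -powRrM mulVf ?powRr1 ?subr_eq0 ?gt_eqF // ltW.
have -> : (b / g) `^ xi = b `^ xi * g `^ (1 - xi) / g.
  have gE : g = g `^ xi * g `^ (1 - xi).
    rewrite -powRD; first by rewrite addrC subrK powRr1 // ltW.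
    by apply/implyP => _; rewrite gt_eqF.
  have gV : g^-1 `^ xi = (g `^ xi)^-1.
    by rewrite -(powR_inv1 (ltW g0)) -powRrM mulN1r powRN.
  rewrite powRM ?invr_ge0 ?ltW // gV -mulrA; congr (_ * _).
  apply: (mulfI (lt0r_neq0 gx)); rewrite mulrA -gE !mulfV // gt_eqF //.
rewrite ltr_pM2r ?invr_gt0 // (le_lt_trans (ler_norm A)) //.
by rewrite mulrC -ltr_pdivrMr // (lt_le_trans _ Eg) // ltrDl.
Qed.

Lemma sqr_le_min_of_lt_min (c a g t b : R) : 0 <= c -> 0 <= a -> 0 <= g ->
  t <= 1 -> b <= 1 -> c < Num.min (t * a) (b * g) ->
  c ^+ 2 <= Num.min (a ^+ 2) (g ^+ 2).
Proof.
move=> c0 a0 g0 t1 b1; rewrite lt_min le_min => /andP[ca cg].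
by rewrite !ler_pXn2r ?nnegrE //; apply/andP; split; nra.
Qed.

End Bounds.

(** * Size of the normal and tangential steps *)

Section Steps.
Context {R : realType} {d m p : nat}.
Variables (F : 'cV[R]_d -> 'cV[R]_m) (C : 'cV[R]_d -> 'cV[R]_p).
Variables (x : 'cV[R]_d) (y : 'cV[R]_p) (z : step3 R d).

Lemma mc0 l : mc C x l 0 = half_sqnorm C x.
Proof. by rewrite /mc mulmx0 addr0 enorm0 expr0n mulr0 addr0. Qed.

Lemma predcE : predc C x z = - dot (C x) (jac C x *m nv z)
  - 2^-1 * enorm (jac C x *m nv z) ^+ 2 - 2^-1 * lam z * enorm (nv z) ^+ 2.
Proof.
rewrite /predc /half_sqnorm /mc !sqr_enorm dotDl !dotDr (dotC (_ *m _) (C x)).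
by field.
Qed.

Lemma dot_Hmat l (v : 'cV[R]_d) :
  dot (Hmat F x l *m v) v = enorm (jac F x *m v) ^+ 2 + l * enorm v ^+ 2.
Proof.
rewrite /Hmat mulmxDl mul_scalar_mx dotDl dotZl -mulmxA dot_mulmxl trmxK.
by rewrite !sqr_enorm.
Qed.

Hypothesis lam0 : 0 < lam z.

(** As pred^c >= 0, lam |n|^2 / 2 <= -<C, J n> <= K |C| |n|; divide by |n|. *)
Lemma normal_step_le K : 0 <= K ->
  (forall v, enorm (jac C x *m v) <= K * enorm v) ->
  0 <= predc C x z -> lam z * enorm (nv z) <= 2 * K * enorm (C x).
Proof.
move=> K0 JK; rewrite predcE.
have := le_dot_norm (C x) (jac C x *m nv z); rewrite ler_norml => /andP[+ _].
have := ler_wpM2l (enorm_ge0 (C x)) (JK (nv z)).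
have := sqr_ge0 (enorm (jac C x *m nv z)).
have := enorm_ge0 (C x); have := enorm_ge0 (nv z).
set c := enorm (C x); set n := enorm (nv z); set q := _ ^+ 2; set D := dot _ _.
rewrite le_eqVlt => /predU1P[<-|n0] c0 q0 H1 H2 pc0.
  by rewrite mulr0 !mulr_ge0.
rewrite -(ler_pM2r n0); lra.
Qed.

(** Drop |J^F t|^2 and complete the square: 2 lam pred^t <= |g|^2 - (lam |t| - |g|)^2, with g
    standing for [ghat]. *)
Lemma predt_le : 2 * lam z * predt F C x y z <= enorm (ghat F C x y z) ^+ 2.
Proof.
rewrite /predt dot_Hmat; have := le_dot_norm (ghat F C x y z) (ttil z).
rewrite ler_norml => /andP[].
set g := enorm _; set t := enorm _; set D := dot _ _; set q := _ ^+ 2.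
have : 0 <= q by exact: sqr_ge0.
have : 0 <= (lam z * t - g) ^+ 2 by exact: sqr_ge0.
move: lam0; nra.
Qed.

Lemma tangential_step_le : 0 <= predt F C x y z ->
  lam z * enorm (ttil z) <= 2 * enorm (ghat F C x y z).
Proof.
rewrite /predt dot_Hmat; have := le_dot_norm (ghat F C x y z) (ttil z).
rewrite ler_norml => /andP[].
have := enorm_ge0 (ttil z); have := enorm_ge0 (ghat F C x y z).
set g := enorm _; set t := enorm _; set D := dot _ _; set q := _ ^+ 2.
have : 0 <= q by exact: sqr_ge0.
move: lam0; nra.
Qed.

(** The term lam n of H n does not grow with lam, because lam |n| <= 2 KC^2; as lam >= 1, |n| obeys
    the same bound. *)
Lemma gvec_le KF KC ky : 0 <= KF -> 0 <= KC ->
  value_jac_bound F KF x -> value_jac_bound C KC x -> enorm y <= ky ->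
  1 <= lam z -> 0 <= predc C x z ->
  enorm (gvec F C x y z) <= KF ^+ 2 + KC * ky + (KF ^+ 2 + 1) * (2 * KC ^+ 2).
Proof.
move=> KF0 KC0 [Fx JF JFT] [Cx JC JCT] yk l1 pc0.
have nl : lam z * enorm (nv z) <= 2 * KC ^+ 2.
  apply: le_trans (normal_step_le KC0 JC pc0) _.
  by rewrite expr2 mulrA ler_wpM2l // mulr_ge0.
have n0 := enorm_ge0 (nv z).
have nl1 : enorm (nv z) <= lam z * enorm (nv z) by rewrite ler_peMl.
apply: le_trans (ler_enormD _ _) _; apply: lerD.
  apply: le_trans (ler_enormD _ _) _; apply: lerD.
    by apply: le_trans (JFT _) _; rewrite expr2 ler_wpM2l.
  by apply: le_trans (JCT _) _; rewrite ler_wpM2l.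
rewrite /Hmat mulmxDl mul_scalar_mx -mulmxA.
apply: le_trans (ler_enormD _ _) _; rewrite mulrDl mul1r; apply: lerD.
  apply: le_trans (JFT _) _; rewrite expr2 -mulrA ler_wpM2l //.
  apply: le_trans (JF _) _; rewrite ler_wpM2l //.
  exact: le_trans nl1 nl.
by rewrite enormZ gtr0_norm.
Qed.

End Steps.

(** * Trials of an execution and their acceptance *)

Section Algorithm.
Context {R : realType} {d m p : nat}.
Variables (F : 'cV[R]_d -> 'cV[R]_m) (C : 'cV[R]_d -> 'cV[R]_p).
Variables (P : params R) (r : run R d p).
Hypotheses (hP : valid_params m P) (hr : is_execution F C P r).

Lemma gam_gt0 j i : (i <= rej r j)%N -> 0 < gam (tr r j i).
Proof.
elim: i => [|i IH] ij.
  case: j {ij} => [|j]; first exact: gam0_gt0 hr.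
  by rewrite (next_gam hr) lt_max (gmin_gt0 hP).
have [_ [-> _]] := rejectP hr ij.
apply: mulr_gt0; last exact: IH (ltnW ij).
exact: lt_trans ltr01 (ghat2_range hP).
Qed.

(** A rejection increases [gam], while [lam] is either kept or reset to the new [gam]. *)
Lemma lam_bounds j i : (i <= rej r j)%N ->
  0 < lam (st3 (tr r j i)) <= gam (tr r j i).
Proof.
elim: i => [|i IH] ij.
  by rewrite (step3_first hr) lexx (gam_gt0 ij).
have [_ [gE [->|lE]]] := rejectP hr ij; last by rewrite lE lexx (gam_gt0 ij).
have /andP[-> le_lg] := IH (ltnW ij); rewrite gE (le_trans le_lg) //=.
apply: ler_peMl; last exact: ltW (ghat2_range hP).
exact/ltW/(gam_gt0 (ltnW ij)).
Qed.

Lemma predc_ge j i : (i <= rej r j)%N ->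
  kappa1 P * enorm (C (xs r j)) ^+ 2 /
    (opnorm (jac C (xs r j)) ^+ 2 + lam (st3 (tr r j i)))
  <= predc C (xs r j) (st3 (tr r j i)).
Proof.
by move=> ij; have [+ _ _] := step3P hr ij; rewrite /condN mc0.
Qed.

Lemma predc_ge0 j i : (i <= rej r j)%N -> 0 <= predc C (xs r j) (st3 (tr r j i)).
Proof.
move=> ij; apply: le_trans (predc_ge ij).
have /andP[/ltW l0 _] := lam_bounds ij; have k0 := ltW (kappa1_gt0 hP).
by apply: divr_ge0; [apply: mulr_ge0|apply: addr_ge0]; rewrite ?sqr_ge0.
Qed.

Lemma predt_ge0 j i : (i <= rej r j)%N ->
  0 <= predt F C (xs r j) (ys r j) (st3 (tr r j i)).
Proof.
move=> ij; have [_ _] := step3P hr ij; apply: le_trans.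
have /andP[/ltW l0 _] := lam_bounds ij; have k0 := ltW (kappa2_gt0 hP).
by apply: divr_ge0; [apply: mulr_ge0|apply: addr_ge0]; rewrite ?sqr_ge0.
Qed.

(* As alpha, beta < 1, the special value of R_j in Step 2 also dominates
   |C_j|^2. *)
Lemma le_Rs j : enorm (C (xs r j)) ^+ 2 <= Rs r j.
Proof.
have := step2P hr j; rewrite /step2_ok; case: ifP => [cmin [-> _]|_ [-> //]].
apply: sqr_le_min_of_lt_min cmin; rewrite ?enorm_ge0 // ?ltW ?(aseq_gt0 hP) //.
  by have := alpha_range hP; lra.
by have := beta_range hP; lra.
Qed.

(** Both branches of Step 5 include this test. *)
Lemma accepted_raredc j T : accepted F C P r j T ->
  rho1 P * predc C (xs r j) (st3 T) <= raredc C P r j T.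
Proof. by rewrite /accepted; case: ifP => // _ /andP[]. Qed.

(* The equation [lam = gam] says that the outcome of Step 3 belongs to the
   current parameter: nothing can be said of trials that reuse a Step 3
   computed for a smaller one. *)
Lemma fresh_trial_accepted (h1 : A1 r) (h2 : A2 F C) (h3 : A3 C r) (h4 : A4 r)
  (e : R) : 0 < e -> exists G : R, forall j i, (i <= rej r j)%N ->
  e <= enorm (C (xs r j)) ^+ 2 -> lam (st3 (tr r j i)) = gam (tr r j i) ->
  G <= gam (tr r j i) -> accepted F C P r j (tr r j i).
Proof.
move=> e0.
have [Om [cOm xOm _]] := h1; have [F1 C1' _ Lphi _] := h2.
have [_ [kW [_ kW0 _ WK]]] := h3; have [ky ky0 yK] := h4.
have [KF KF0 HF] := C1_bounds cOm F1; have [KC KC0 HC] := C1_bounds cOm C1'.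
have dphi x : differentiable (half_sqnorm C) x.
  by apply: differentiable_half_sqnorm; case: C1'.
have [L L0 HL] := lipschitz_grad_upper dphi Lphi.
(* The constants below serve as follows: [KG] bounds |g_j|, [B] bounds |ghat_j|, [S / gam] bounds
   |s_j|, [D / gam^2] bounds the loss of the actual reduction of phi against pred^c, and [b / gam]
   is a lower bound for pred^c. *)
set KG := KF ^+ 2 + KC * ky + (KF ^+ 2 + 1) * (2 * KC ^+ 2).
have KG0 : 0 <= KG.
  by rewrite !addr_ge0 ?mulr_ge0 ?addr_ge0 ?mulr_ge0 ?sqr_ge0 // ltW.
pose B := kW * KG; pose S := 2 * KC ^+ 2 + (2 * B + xi2 P).
pose D := KC ^+ 2 * xi2 P + L * S ^+ 2.
pose b := kappa1 P * e / (KC ^+ 2 + 1).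
have k10 := kappa1_gt0 hP; have xi20 := xi2_gt0 hP.
have rho : 0 < 1 - rho1 P by have := rho1_range hP; lra.
have B0 : 0 <= B by rewrite mulr_ge0 // ltW.
have b0 : 0 < b by rewrite divr_gt0 ?mulr_gt0 // ltr_wpDl ?sqr_ge0.
have xir : 0 < xi P < 1 by have := xi_range hP; lra.
have [G1 HG1] := linear_decay_lt_powR (B ^+ 2) b0 xir.
(* The three thresholds give, in order, lam >= 1, the failure of the test on pred^t, and D / gam^2
   <= (1 - rho1) pred^c. *)
exists (Num.max 1 (Num.max G1 (D / ((1 - rho1 P) * b)))) => j i ij ce lE.
rewrite !ge_max => /and3P[g1 gG1 gD].
have gam0 := gam_gt0 ij.
have pc0 := predc_ge0 ij; have pt0 := predt_ge0 ij; have pc := predc_ge ij.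
have HP := step4P hr ij; have prj := Ws_proj hr j.
have WK' := WK _ _ ij; move: lE HP pc pc0 pt0 gam0 g1 gG1 gD WK'.
rewrite /accepted /condP /sv.
set T := tr r j i; set z := st3 T; set g := gam T; set x := xs r j; set y := ys r j.
move=> lE HP pc pc0 pt0 gam0 g1 gG1 gD WK'.
have l0 : 0 < lam z by rewrite lE.
have HFx := HF _ (xOm j); have HCx := HC _ (xOm j).
have [Cx JC _] := HCx.
have mulg u v : u <= v -> g * u <= g * v by rewrite ler_pM2l.
have gvK : enorm (gvec F C x y z) <= KG by apply: gvec_le; rewrite ?lE //; exact: yK.
have ghB : enorm (ghat F C x y z) <= B.
  by apply: le_trans (WK' _) _; rewrite ler_wpM2l // ltW.
have nK : g * enorm (nv z) <= 2 * KC ^+ 2.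
  rewrite -lE; apply: le_trans (normal_step_le KC0 JC pc0) _.
  by rewrite expr2 mulrA ler_wpM2l // mulr_ge0.
(* By (P), t is within xi2 / gam^2 of W ttil, and W does not increase norms. *)
have tK : g * enorm (tv T) <= 2 * B + xi2 P.
  have tD := ler_enormD (Ws r j *m ttil z) (tv T - Ws r j *m ttil z).
  rewrite addrC subrK in tD.
  apply: le_trans (mulg _ _ tD) _.
  rewrite mulrDr; apply: lerD.
    apply: le_trans (_ : 2 * enorm (ghat F C x y z) <= _); last by rewrite ler_wpM2l.
    apply: le_trans (_ : g * enorm (ttil z) <= _).
      by rewrite ler_wpM2l ?(ltW gam0) // (projection_enorm_le _ prj).
    by rewrite -lE; exact: tangential_step_le.
  apply: le_trans (mulg _ _ HP) _.
  rewrite mulrA ler_pdivrMr ?exprn_gt0 // mulrC ler_pM2l //.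
  by rewrite expr2 ler_peMl // ltW.
have sK : g * enorm (nv z + tv T) <= S.
  apply: le_trans (mulg _ _ (ler_enormD _ _)) _.
  by rewrite mulrDr lerD.
have pcb : b / g <= predc C x z.
  apply: le_trans pc; rewrite lE /b -[leLHS]mulrA -invfM.
  have opK := opnorm_sqr_le JC.
  have op0 := sqr_ge0 (opnorm (jac C x)); have K20 := sqr_ge0 KC.
  have opg : 0 < opnorm (jac C x) ^+ 2 + g by rewrite ltr_wpDl.
  have Kg : 0 < (KC ^+ 2 + 1) * g by rewrite mulr_gt0 // ltr_wpDl.
  apply: ler_pM; rewrite ?invr_ge0 ?ler_pM2l //; try exact: ltW.
    by rewrite mulr_ge0 // ltW.
  rewrite lef_pV2 ?posrE // mulrDl mul1r lerD // (le_trans opK) //.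
  by rewrite ler_peMr.
have gi0 : 0 < (g ^+ 2)^-1 by rewrite invr_gt0 exprn_gt0.
(* Descent lemma for phi at x. As J W = 0, only t - W ttil contributes to J t, which is therefore
   O(1 / gam^2). *)
have ared : predc C x z - D / g ^+ 2 <=
    half_sqnorm C x - half_sqnorm C (x + (nv z + tv T)).
  have := HL x (nv z + tv T).
  rewrite dot_grad_half_sqnorm; last by case: C1'.
  rewrite mulmxDr dotDr.
  have Jt : dot (C x) (jac C x *m tv T) <= KC ^+ 2 * xi2 P / g ^+ 2.
    have -> : jac C x *m tv T = jac C x *m (tv T - Ws r j *m ttil z).
      by rewrite mulmxBr (projection_null _ prj) subr0.
    apply: le_trans (dot_le_enorm _ _) _.
    rewrite expr2 -!mulrA ler_pM ?enorm_ge0 // (le_trans (JC _)) //.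
    by rewrite ler_wpM2l.
  have Ls : L * enorm (nv z + tv T) ^+ 2 <= L * S ^+ 2 / g ^+ 2.
    rewrite -mulrA ler_wpM2l // ler_pdivlMr ?exprn_gt0 // mulrC -exprMn.
    by rewrite ler_pXn2r ?nnegrE ?mulr_ge0 ?enorm_ge0
      ?(le_trans _ sK) ?mulr_ge0 ?enorm_ge0 // ltW.
  rewrite predcE /D mulrDl.
  have := sqr_ge0 (enorm (jac C x *m nv z)).
  have := mulr_ge0 (ltW l0) (sqr_ge0 (enorm (nv z))).
  lra.
have rared : rho1 P * predc C x z <= raredc C P r j T.
  have DG : D / g ^+ 2 <= (1 - rho1 P) * predc C x z.
    apply: le_trans (_ : (1 - rho1 P) * (b / g) <= _); last first.
      by rewrite ler_pM2l.
    rewrite expr2 invfM [leLHS]mulrA [leRHS]mulrA ler_pM2r ?invr_gt0 //.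
    have rb0 : 0 < (1 - rho1 P) * b by exact: mulr_gt0.
    by move: gD; rewrite (ler_pdivrMr _ _ rb0) (ler_pdivrMr _ _ gam0) [g * _]mulrC.
  have : enorm (C x) ^+ 2 <= Num.max (Rs r j) (avgC C P r j).
    by rewrite le_max le_Rs.
  move: DG ared; rewrite /raredc /half_sqnorm /sv -/z -/x.
  set q := D / _; set u := predc _ _ _; set M := Num.max _ _.
  lra.
(* The branch testing the Lagrangian is impossible: pred^t <= B^2 / gam < (b / gam)^xi <=
   (pred^c)^xi. *)
case: ifP => // /andP[+ _].
rewrite ge_max => /andP[_]; rewrite leNgt => /negP[].
apply: lt_le_trans (_ : (b / g) `^ xi P <= _); last first.
  have x0 : 0 <= xi P by case/andP: xir => /ltW.
  by apply: (ge0_ler_powR x0 _ _ pcb); rewrite nnegrE // ltW // divr_gt0.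
apply: le_lt_trans (HG1 _ gG1 gam0); rewrite ler_pdivlMr //.
have := predt_le F C x y l0; rewrite lE => pt.
have : enorm (ghat F C x y z) ^+ 2 <= B ^+ 2.
  by rewrite ler_pXn2r ?nnegrE ?enorm_ge0.
by have := mulr_ge0 (ltW gam0) pt0; lra.
Qed.
End Algorithm.

(** * Convergence *)

Section Convergence.
Context {R : realType} {d m p : nat}.
Variables (F : 'cV[R]_d -> 'cV[R]_m) (C : 'cV[R]_d -> 'cV[R]_p).
Variables (P : params R) (r : run R d p).
Hypotheses (hP : valid_params m P) (hr : is_execution F C P r).

Let c (j : nat) : R := enorm (C (xs r j)) ^+ 2.
Let predc_acc (j : nat) : R := predc C (xs r j) (st3 (tr r j (rej r j))).

Let c_ge0 j : 0 <= c j. Proof. exact: sqr_ge0. Qed.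
Let nu0 : (0 < nu P)%N. Proof. exact: nu_gt0 hP. Qed.
Let mu0 : 0 < mu P. Proof. by case/andP: (mu_range hP). Qed.
Let mucge j k : (k < minn j.+1 (nu P))%N -> mu P <= muc r j k.
Proof. by have [H _ _ _] := weightsP hr j; exact: H. Qed.
Let mucsum j : \sum_(k < minn j.+1 (nu P)) muc r j k = 1.
Proof. by have [_ _ H _] := weightsP hr j. Qed.
Let avgE j : avgC C P r j = window_avg c (nu P) (muc r) j. Proof. by []. Qed.

Lemma constraint_decrease j :
  c j.+1 <= Num.max (Rs r j) (avgC C P r j) - 2 * rho1 P * predc_acc j.
Proof.
have := accepted_raredc (acceptP hr j).
by rewrite /c /predc_acc (next_x hr) /raredc; lra.
Qed.

Lemma constraint_le_max j : c j.+1 <= Num.max (Rs r j) (avgC C P r j).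
Proof.
apply: le_trans (constraint_decrease j) _; rewrite gerBl.
have /andP[/ltW r0 _] := rho1_range hP.
apply: mulr_ge0; first exact: mulr_ge0.
exact: (predc_ge0 hP hr (leqnn _)).
Qed.

(* Either k_j is incremented, or R_j can be replaced by |C_j|^2. *)
Lemma step2_cases j : (Rs r j <= aseq P (ks r j) ^+ 2 /\ avgC C P r j <= Rs r j /\
    ks r j.+1 = (ks r j).+1) \/
  (Num.max (Rs r j) (avgC C P r j) <= Num.max (c j) (avgC C P r j) /\
    ks r j.+1 = ks r j).
Proof.
have := step2P hr j; rewrite /step2_ok; case: ifP => [_ [RE ->]|_ [-> ->]]; last first.
  by right; split.
case: ifP => [avgR|/negbT]; first by left; split=> //; rewrite RE ge_min lexx.
rewrite -ltNge => Ravg; right; split=> //.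
by rewrite ge_max !le_max lexx (ltW Ravg) !orbT.
Qed.

Lemma aseq_decr i j : (i <= j)%N -> aseq P j <= aseq P i.
Proof.
elim: j => [|j IH]; first by rewrite leqn0 => /eqP->.
rewrite leq_eqVlt => /predU1P[-> //|ij]; apply: le_trans (IH ij).
have /andP[_] := aseq_ratio hP j.
by rewrite ltr_pdivrMr ?(aseq_gt0 hP) // mul1r => /ltW.
Qed.

Lemma ks_mono i j : (i <= j)%N -> (ks r i <= ks r j)%N.
Proof.
elim: j => [|j IH]; first by rewrite leqn0 => /eqP->.
rewrite leq_eqVlt => /predU1P[-> //|ij]; apply: leq_trans (IH ij) _.
by case: (step2_cases j) => [[_ [_ ->]]|[_ ->]].
Qed.

Lemma cvg_of_ks_unbounded :
  (forall N, exists2 j, (N <= j)%N & ks r j.+1 <> ks r j) -> c @ \oo --> (0 : R).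
Proof.
move=> kinf; have klarge K : exists2 j, (K <= ks r j)%N & ks r j.+1 <> ks r j.
  elim: K => [|K [j Kj jS]]; first by have [j _ jS] := kinf 0%N; exists j.
  have [i ji iS] := kinf j.+1; exists i => //; apply: leq_trans (ks_mono ji).
  by case: (step2_cases j) => [[_ [_ ->]]|[_ /jS]].
have cB K : exists J, forall j, (J <= j)%N ->
    window_max c (nu P) j <= aseq P K ^+ 2 / mu P.
  have [J KJ JS] := klarge K; exists J.
  case: (step2_cases J) => [[RJ [avgR _]]|[_ /JS //]].
  have aK i : (J <= i)%N -> aseq P (ks r i) ^+ 2 <= aseq P K ^+ 2.
    move=> Ji; rewrite ler_pXn2r ?nnegrE ?(ltW (aseq_gt0 hP _)) //.
    exact/aseq_decr/(leq_trans KJ)/ks_mono.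
  (* Needed at later increments of k, where R_j is bounded by a_K^2 only; it holds because mu <=
     1. *)
  have aKB : aseq P K ^+ 2 <= aseq P K ^+ 2 / mu P.
    rewrite ler_pdivlMr // ler_piMr ?sqr_ge0 //.
    exact: (weight_le1 nu0 mucge mucsum).
  (* The increment at [J] bounds the whole window there. Afterwards each new value is at most the
     larger of a_K^2 and the previous window maximum. *)
  suff H i : window_max c (nu P) (J + i) <= aseq P K ^+ 2 / mu P.
    by move=> j Jj; rewrite -(subnKC Jj).
  elim: i => [|i IH].
    rewrite addn0; apply: window_max_le => // [|k kn].
      by rewrite divr_ge0 ?sqr_ge0 // ltW.
    rewrite ler_pdivlMr // mulrC (le_trans _ (aK _ (leqnn J))) //.
    apply: le_trans (le_trans avgR RJ); rewrite avgE.
    exact: (window_avg_ge c_ge0 mu0 mucge).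
  rewrite addnS; apply: window_maxS_le => //.
  apply: le_trans (constraint_le_max _) _.
  have avgB : avgC C P r (J + i) <= aseq P K ^+ 2 / mu P.
    by apply: le_trans IH; rewrite avgE; exact: (window_avg_le_max _ nu0 mu0 mucge mucsum).
  case: (step2_cases (J + i)) => [[Ri _]|[+ _]].
    by rewrite ge_max avgB andbT (le_trans Ri) // (le_trans (aK _ (leq_addr _ _))).
  move/le_trans; apply; rewrite ge_max avgB andbT; apply: le_trans IH.
  exact: (le_window_max0 _ nu0).
have a0 : (fun K => aseq P K ^+ 2 / mu P) @ \oo --> (0 : R).
  rewrite -(mul0r (mu P)^-1) -(mulr0 0); apply: cvgMr_tmp.
  by apply: cvgM; exact: aseq_cvg hP.
apply/cvgrPdist_lt => e e0; move/cvgrPdist_lt: a0 => /(_ _ e0) [K _ /(_ K (leqnn K))] /=.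
rewrite sub0r normrN => aKe; have [J HJ] := cB K; exists J => // j /= Jj.
rewrite sub0r normrN ger0_norm //; apply: le_lt_trans (le_lt_trans (ler_norm _) aKe).
exact: le_trans (le_window_max0 _ nu0 _) (HJ _ Jj).
Qed.

(** Otherwise [gam] is so large at the end of each iteration from [J] on that the next one starts
    above [G]. Its first trial has [lam = gam] and is accepted at once, so [gam] shrinks by the
    factor ghat1 per iteration, yet stays above a positive bound. *)
Lemma small_parameter_often (G : R) (J : nat) :
  (forall j i, (J <= j)%N -> (i <= rej r j)%N ->
    lam (st3 (tr r j i)) = gam (tr r j i) -> G <= gam (tr r j i) ->
    accepted F C P r j (tr r j i)) ->
  exists2 j, (J <= j)%N &
    lam (st3 (tr r j (rej r j))) <= Num.max G (gmin P) / ghat1 P.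
Proof.
move=> accG; apply: contrapT => noj; set G0 := Num.max _ _ in noj.
have gm0 := gmin_gt0 hP; have /andP[gh0 gh1] := ghat1_range hP.
have G00 : 0 < G0 by rewrite lt_max gm0 orbT.
have lamG j : (J <= j)%N -> G0 / ghat1 P < lam (st3 (tr r j (rej r j))).
  by move=> Jj; rewrite ltNge; apply/negP => H; apply: noj; exists j.
(* The division by ghat1 in the bound on [lam] keeps ghat1 gam above [G0], hence above gmin, so the
   maximum in the update is ghat1 gam. *)
have gamS j : (J <= j)%N -> G0 < ghat1 P * gam (tr r j (rej r j)) /\
    gam (tr r j.+1 0) = ghat1 P * gam (tr r j (rej r j)).
  move=> Jj; have /andP[_ lg] := lam_bounds hP hr (leqnn (rej r j)).
  have := lt_le_trans (lamG _ Jj) lg; rewrite ltr_pdivrMr // mulrC => H; split=> //.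
  rewrite (next_gam hr); apply/max_idPr/(le_trans _ (ltW H)).
  by rewrite le_max lexx orbT.
(* The inequality J < j is strict because [gamS] is also applied to the preceding iteration. *)
have gamSS j : (J < j)%N -> gam (tr r j.+1 0) = ghat1 P * gam (tr r j 0).
  case: j => // j Jj; have [H E] := gamS _ Jj.
  have acc : accepted F C P r j.+1 (tr r j.+1 0).
    apply: accG => //; [exact: leqW|exact: step3_first hr _|].
    by rewrite E (le_trans _ (ltW H)) // le_max lexx.
  have rej0 : rej r j.+1 = 0%N.
    apply/eqP; rewrite -leqn0 leqNgt; apply/negP => rej_gt0.
    by have [] := rejectP hr rej_gt0; rewrite acc.
  by have [_] := gamS _ (leqW Jj); rewrite rej0.
have gamE i : gam (tr r (J.+1 + i) 0) = ghat1 P ^+ i * gam (tr r J.+1 0).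
  elim: i => [|i IH]; first by rewrite addn0 mul1r.
  by rewrite addnS gamSS ?IH ?exprS ?mulrA //; lia.
have gamG i : G0 < ghat1 P ^+ i * gam (tr r J.+1 0).
  rewrite -gamE addSn; have [|H ->] := gamS (J + i)%N; first by lia.
  exact: H.
have : (fun i => ghat1 P ^+ i * gam (tr r J.+1 0)) @ \oo --> 0 * gam (tr r J.+1 0).
  by apply: cvgMr_tmp; apply: cvg_expr; rewrite gtr0_norm.
rewrite mul0r => /cvgrPdist_lt /(_ _ G00) [N _ /(_ N (leqnn N))] /=.
rewrite sub0r normrN gtr0_norm; last exact: lt_trans G00 (gamG N).
by rewrite ltNge (ltW (gamG N)).
Qed.

Lemma cvg_of_ks_stationary (h1 : A1 r) (h2 : A2 F C) (h3 : A3 C r) (h4 : A4 r) :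
  (exists N, forall j, (N <= j)%N -> ks r j.+1 = ks r j) -> c @ \oo --> (0 : R).
Proof.
move=> [N kN].
have Rle j : (N <= j)%N ->
    Num.max (Rs r j) (avgC C P r j) <= Num.max (c j) (avgC C P r j).
  move=> Nj; case: (step2_cases j) => [[_ [_]]|[] //].
  by rewrite kN // => /eqP; rewrite -[X in X == _]addn0 -addn1 eqn_add2l.
have c_step j : (N <= j)%N ->
    c j.+1 <= Num.max (c j) (window_avg c (nu P) (muc r) j).
  by move=> Nj; exact: le_trans (constraint_le_max j) (Rle _ Nj).
have [q cq Qq] := nonmonotone_cvg nu0 c_ge0 mu0 mucge mucsum c_step.
have [q0|q_neq0] := eqVneq q 0; first by rewrite -q0.
exfalso.
have q_gt0 : 0 < q.
  by rewrite lt_def q_neq0 -(cvg_lim _ cq) // limr_ge //; [exact: cvgP cq|near=> j].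
have e0 : 0 < q / 2 by rewrite divr_gt0.
have [G accG] := fresh_trial_accepted hP hr h1 h2 h3 h4 e0.
have [Om [cOm xOm _]] := h1; have [_ C1' _ _ _] := h2.
have [K K0 HK] := C1_bounds cOm C1'.
set L := Num.max G (gmin P) / ghat1 P in accG.
have L0 : 0 < L.
  have /andP[gh0 _] := ghat1_range hP.
  by rewrite divr_gt0 // lt_max (gmin_gt0 hP) orbT.
(* Lower bound that (N) gives for pred^c_j when c_j >= q / 2 and the parameter of Step 3 is at most
   [L]. *)
set pmin := kappa1 P * (q / 2) / (K ^+ 2 + L).
have k10 := kappa1_gt0 hP; have /andP[r0 _] := rho1_range hP.
have KL : 0 < K ^+ 2 + L by rewrite ltr_wpDl ?sqr_ge0.
have pmin0 : 0 < 2 * rho1 P * pmin by rewrite !mulr_gt0 // ?divr_gt0 ?invr_gt0 // mulr_gt0.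
(* This difference dominates 2 rho1 pred^c_j from [N] on, so it cannot tend to 0 while pred^c_j >=
   pmin infinitely often. *)
have dcvg : (fun j => window_max c (nu P) j - c j.+1) @ \oo --> (0 : R).
  rewrite -(subrr q); apply: cvgB => //.
  by rewrite cvg_shiftS.
have [N1 _ cN1] : \forall j \near \oo, q / 2 <= c j.
  by move/cvgrPdist_lt: cq => /(_ _ e0); apply: filterS => j; rewrite ltr_norml => /andP[]; lra.
have [N2 _ dN2] : \forall j \near \oo,
    window_max c (nu P) j - c j.+1 < 2 * rho1 P * pmin.
  move/cvgrPdist_lt: dcvg => /(_ _ pmin0); apply: filterS => j.
  by rewrite sub0r normrN => /(le_lt_trans (ler_norm _)).
have [|j Mj lamj] := @small_parameter_often G (maxn N (maxn N1 N2)).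
  move=> j i; rewrite !geq_max => /and3P[_ N1j _] ij.
  by apply: accG => //; exact: cN1.
move: Mj; rewrite !geq_max => /and3P[Nj N1j N2j].
have pminj : pmin <= predc_acc j.
  apply: le_trans (predc_ge hr (leqnn (rej r j))).
  have /andP[l0 _] := lam_bounds hP hr (leqnn (rej r j)).
  have [_ JK _] := HK _ (xOm j); have opK := opnorm_sqr_le JK.
  have op0 := sqr_ge0 (opnorm (jac C (xs r j))).
  apply: ler_pM; rewrite ?invr_ge0 ?(ltW KL) ?ler_pM2l //.
  - exact: ltW (mulr_gt0 k10 e0).
  - exact: cN1.
  by rewrite lef_pV2 ?posrE ?lerD // ltr_wpDl.
have := le_trans (constraint_decrease j) (lerB (Rle _ Nj) (lexx _)).
have : Num.max (c j) (avgC C P r j) <= window_max c (nu P) j.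
  by rewrite ge_max le_window_max0 //= (window_avg_le_max _ nu0 mu0 mucge mucsum).
have := dN2 _ N2j; have : 2 * rho1 P * pmin <= 2 * rho1 P * predc_acc j.
  by rewrite ler_pM2l // mulr_gt0.
rewrite /=; lra.
Unshelve. all: by end_near. Qed.

Lemma constraint_sqnorm_cvg (h1 : A1 r) (h2 : A2 F C) (h3 : A3 C r) (h4 : A4 r) :
  (fun j => enorm (C (xs r j)) ^+ 2) @ \oo --> (0 : R).
Proof.
have [|H] := pselect (exists N, forall j, (N <= j)%N -> ks r j.+1 = ks r j).
  exact: cvg_of_ks_stationary.
apply: cvg_of_ks_unbounded => N; apply: contrapT => HN; apply: H; exists N => j Nj.
by apply: contrapT => jS; apply: HN; exists j.
Qed.

End Convergence.

Theorem theorem3p9 (R : realType) (d m p : nat)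
  (F : 'cV[R]_d -> 'cV[R]_m) (C : 'cV[R]_d -> 'cV[R]_p)
  (P : params R) (r : run R d p)
  (hP : valid_params m P)
  (hr : is_execution F C P r)
  (h1 : A1 r) (h2 : A2 F C) (h3 : A3 C r) (h4 : A4 r) :
  (fun j => enorm (C (xs r j))) @ \oo --> (0 : R).
Proof.
have -> : (fun j => enorm (C (xs r j))) =
    Num.sqrt \o (fun j => enorm (C (xs r j)) ^+ 2).
  by apply/funext => j /=; rewrite sqrtr_sqr ger0_norm ?enorm_ge0.
have cc := constraint_sqnorm_cvg hP hr h1 h2 h3 h4.
rewrite -(@sqrtr0 R); exact: (cvg_comp _ _ cc (@sqrt_continuous R 0)).
Qed.
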